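(* Fix an integer $\lambda\ge1$. Let $\mathcal{C}\subseteq S_{n+1}$ be a random subset in which each permutation of $S_{n+1}$ is included independently with probability $p=p(n)$. Let $X=X_\lambda$ denote the number of permutations in $S_n$ that are covered by more than $\lambda$ members of $\mathcal{C}$. Then, as $n\to\infty$, \[ p\ll\frac{1}{n^2}\cdot\frac{1}{(n!)^{1/(\lambda+1)}}\Rightarrow\mathbb{P}(X=0)\to1, \] and \[ p\gg\frac{1}{n^{2\lambda/(\lambda+1)}}\cdot\frac{1}{(n!)^{1/(\lambda+1)}}\Rightarrow\mathbb{P}(X=0)\to0. \]
   Context: $S_m$ is the set of permutations of $[m]$, viewed as sequences. A permutation $\rho\in S_{n+1}$ covers $\pi\in S_n$ if some subsequence of length $n$ of $\rho$ is order-isomorphic to $\pi$. For nonnegative functions, $f\ll g$ (equivalently $g\gg f$) means $f=o(g)$ as $n\to\infty$. *)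

(* Defs.v *)
From HB Require Import structures.
From mathcomp Require Import all_boot all_order all_algebra all_fingroup.
From mathcomp Require Import all_classical all_reals all_analysis.

Set Implicit Arguments.
Unset Strict Implicit.
Unset Printing Implicit Defensive.

Import Order.TTheory GRing.Theory Num.Theory.
Import numFieldNormedType.Exports.

Local Open Scope classical_set_scope.
Local Open Scope ring_scope.

(* A permutation s : 'S_m is viewed as the sequence s 0, ..., s (m - 1); the
   positions of a length-n subsequence are given by an increasing map f. *)
Definition covers (n : nat) (rho : 'S_n.+1) (pi : 'S_n) : bool :=
  [exists f : {ffun 'I_n -> 'I_n.+1},
     [forall i : 'I_n, forall j : 'I_n, (i < j)%N ==> (f i < f j)%N] &&
     [forall i : 'I_n, forall j : 'I_n,
        (rho (f i) < rho (f j))%N == (pi i < pi j)%N]].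

Definition num_overcovered (lambda n : nat) (C : {set 'S_n.+1}) : nat :=
  #|[set pi : 'S_n | (lambda < #|[set rho in C | covers rho pi]|)%N]|.

Definition mutually_independent (R : realType) (d : measure_display)
    (Omega : measurableType d) (P : probability Omega R)
    (I : finType) (E : I -> set Omega) : Prop :=
  forall J : {set I},
    P (\bigcap_(i in [set` J]) E i) = (\prod_(i in J) P (E i))%E.

Definition binomial_random_subset (R : realType) (d : measure_display)
    (Omega : measurableType d) (P : probability Omega R)
    (I : finType) (p : R) (C : Omega -> {set I}) : Prop :=
  [/\ forall i, measurable [set w | i \in C w],
      forall i, P [set w | i \in C w] = p%:E
    & mutually_independent P (fun i => [set w | i \in C w])].

(* Main.v *)
Require Import Defs.
From HB Require Import structures.
From mathcomp Require Import all_boot all_order all_algebra all_fingroup.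
From mathcomp Require Import all_classical all_reals all_analysis.
From mathcomp Require Import zify ring lra.

(* Put k = lambda + 1 and let Y be the number of pairs (pi, S) where S is a
   k-subset of C all of whose members cover pi, so that X = 0 iff Y = 0.
   A permutation of size n is covered by at least n (n - 1) and at most
   (n + 1)^2 permutations, hence E Y is of order n! t^k with t = (n + 1)^2 p,
   and the first part is Markov's inequality for Y.
   For the second part, apply Chebyshev's inequality to Y.  Since a permutation
   of size n + 1 covers at most n + 1 others, the pairs (pi', S') with S' meeting
   a given S contribute O(n max(1, t)^(k - 1)) to the conditional mean, so
   P(Y = 0) = O(n max(1, t)^(k - 1) / (n! t^k)).  The hypothesis gives
   n! t^k >= n^2 eventually, and this bound is then O(1/n) whether or not t <= 1.
   Counting pairs (pi, S) rather than the pi makes the variance ratio decreasing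
   in p, so that large p needs no coupling argument. *)

Set Implicit Arguments.
Unset Strict Implicit.
Unset Printing Implicit Defensive.

Import Order.TTheory GRing.Theory Num.Theory.
Import numFieldNormedType.Exports.

Local Open Scope ring_scope.

(** * Permutations covering a given permutation *)

Lemma card_ord_lt (n : nat) (i : 'I_n) : #|[set j : 'I_n | (j < i)%N]| = i.
Proof.
have -> : [set j : 'I_n | (j < i)%N] = [set widen_ord (ltnW (ltn_ord i)) j | j : 'I_i].
  apply/setP => j; rewrite inE; apply/idP/imsetP => [ji|[k _ ->]] //=.
  by exists (Ordinal ji) => //; apply/val_inj.
by rewrite card_imset ?card_ord // => j k /(congr1 val) /= /val_inj.
Qed.

(** The value of a permutation at [i] is the number of positions with a smaller value, and this rank
    depends on the comparisons alone. *)
Lemma order_isomorphic_perm_eq (n : nat) (s t : 'S_n) :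
  (forall i j, (s i < s j)%N = (t i < t j)%N) -> s = t.
Proof.
have rank (u : 'S_n) i : #|[set j | (u j < u i)%N]| = u i.
  rewrite -[RHS]card_ord_lt -[LHS](card_imset _ (@perm_inj _ u)); congr #|pred_of_set _|.
  apply/setP => j; rewrite inE; apply/imsetP/idP => [[k]|ji]; first by rewrite inE => ? ->.
  by exists ((u^-1)%g j); rewrite ?inE permKV.
move=> st; apply/permP => i; apply/val_inj; rewrite -[LHS]rank -[RHS]rank.
by congr #|pred_of_set _|; apply/setP => j; rewrite !inE st.
Qed.

Lemma ltn_lift (n : nat) (h : 'I_n.+1) (i j : 'I_n) :
  (lift h i < lift h j)%N = (i < j)%N.
Proof. by rewrite !ltnNge leq_bump2. Qed.

(** Deleting position [i] and value [rho i], then renumbering, leaves a permutation [s]; [lift_perm]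
    reinserts the deleted entry. *)
Lemma lift_permP (n : nat) (i : 'I_n.+1) (rho : 'S_n.+1) :
  exists s : 'S_n, rho = lift_perm i (rho i) s.
Proof.
have ex k : {l | rho (lift i k) = lift (rho i) l}.
  have ne : rho i != rho (lift i k) by rewrite (inj_eq perm_inj) neq_lift.
  by have [l ->] := unlift_some ne; exists l.
have inj : injective (fun k => sval (ex k)).
  move=> a b /(congr1 (lift (rho i))).
  by rewrite -(svalP (ex a)) -(svalP (ex b)) => /perm_inj /lift_inj.
exists (perm inj); apply/permP => j; case: (unliftP i j) => [k|] ->.
  by rewrite lift_perm_lift permE; exact: svalP (ex k).
by rewrite lift_perm_id.
Qed.

(** By cardinality [f] misses some [h], so it factors through [lift h]. The other factor is an
    order-preserving permutation, hence the identity. *)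
Lemma increasing_skip_one (n : nat) (f : 'I_n -> 'I_n.+1) :
  (forall i j : 'I_n, (i < j)%N -> (f i < f j)%N) ->
  exists h : 'I_n.+1, forall i, f i = lift h i.
Proof.
move=> inc.
have mono i j : (f i < f j)%N = (i < j)%N.
  apply/idP/idP => [|/inc//]; apply: contraTT; rewrite -!leqNgt leq_eqVlt.
  by case/predU1P => [/val_inj ->//|/inc/ltnW].
have f_inj : injective f.
  move=> i j e; apply/val_inj; case: (ltngtP i j) => // /inc; rewrite e ltnn //.
have [h hf] : exists h, h \notin codom f.
  have lt : (#|[set f i | i : 'I_n]| < #|'I_n.+1|)%N.
    by rewrite card_imset // !card_ord.
  have /subsetPn[h _ hf] : ~~ ([set: 'I_n.+1] \subset [set f i | i : 'I_n]).
    by apply/negP => /subset_leq_card; rewrite cardsT leqNgt lt.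
  by exists h; apply: contra hf => /codomP[i ->]; exact: imset_f.
have ex i : {l | f i = lift h l}.
  have ne : h != f i by apply: contra hf => /eqP ->; exact: codom_f.
  by have [l ->] := unlift_some ne; exists l.
have g_inj : injective (fun i => sval (ex i)).
  by move=> a b /(congr1 (lift h)); rewrite -(svalP (ex a)) -(svalP (ex b)) => /f_inj.
have g1 : perm g_inj = 1%g.
  apply: order_isomorphic_perm_eq => i j; rewrite !permE -(ltn_lift h).
  by rewrite -(svalP (ex i)) -(svalP (ex j)) mono.
exists h => i; rewrite (svalP (ex i)); congr lift.
by have /permP/(_ i) := g1; rewrite !permE.
Qed.

(** Replaces order-isomorphic subsequences by the insertion of one entry, the form in which both
    shadows are counted. *)
Lemma coversP (n : nat) (rho : 'S_n.+1) (pi : 'S_n) :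
  reflect (exists i j, rho = lift_perm i j pi) (covers rho pi).
Proof.
apply: (iffP existsP) => [[f /andP[/forallP inc /forallP iso]]|[i [j ->]]].
  have [a b ab|h fE] := @increasing_skip_one _ f.
    by have /forallP/(_ b)/implyP := inc a; apply.
  have [s rhoE] := lift_permP h rho; exists h, (rho h).
  rewrite [LHS]rhoE; congr lift_perm; apply: order_isomorphic_perm_eq => a b.
  have /forallP/(_ b)/eqP <- := iso a.
  by rewrite !fE rhoE !lift_perm_lift ltn_lift.
exists [ffun a => lift i a]; apply/andP; split; apply/forallP => a; apply/forallP => b.
  by apply/implyP => ab; rewrite !ffunE ltn_lift.
by rewrite !ffunE !lift_perm_lift ltn_lift.
Qed.

Definition upper_shadow (n : nat) (pi : 'S_n) : {set 'S_n.+1} :=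
  [set rho | covers rho pi].

Lemma card_upper_shadow_le (n : nat) (pi : 'S_n) :
  (#|upper_shadow pi| <= n.+1 ^ 2)%N.
Proof.
have sub : upper_shadow pi \subset [set lift_perm x.1 x.2 pi | x : 'I_n.+1 * 'I_n.+1].
  apply/fintype.subsetP => rho; rewrite inE => /coversP[i [j ->]].
  by apply/imsetP; exists (i, j).
apply: (leq_trans (subset_leq_card sub)); apply: (leq_trans (leq_imset_card _ _)).
by rewrite card_prod card_ord mulnn.
Qed.

Lemma lift_perm_inj (n : nat) (i j : 'I_n.+1) : injective (@lift_perm n i j).
Proof.
move=> s t e; apply/permP => k; apply: (@lift_inj _ j).
by rewrite -!(lift_perm_lift i) e.
Qed.

(** A covered permutation is determined by the deleted position, since the deleted value is then
    [rho i]. *)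
Lemma card_covered_le (n : nat) (rho : 'S_n.+1) :
  (#|[set pi | covers rho pi]| <= n.+1)%N.
Proof.
have sub : [set pi | covers rho pi] \subset
    (* The default [1%g] only makes the map total; the proof uses it at positions where a suitable
       [pi] exists. *)
    [set odflt 1%g [pick pi | rho == lift_perm i (rho i) pi] | i : 'I_n.+1].
  apply/fintype.subsetP => pi; rewrite inE => /coversP[i [j E]].
  apply/imsetP; exists i => //; case: pickP => [pi' /eqP E'|/(_ pi)] /=.
    by move: E'; rewrite {1}E => E'; move: E'; rewrite E lift_perm_id => /lift_perm_inj.
  by rewrite {1}E {1}E lift_perm_id eqxx.
apply: (leq_trans (subset_leq_card sub)); apply: (leq_trans (leq_imset_card _ _)).
by rewrite card_ord.
Qed.

(* The pair (i, v) means: insert the value v in front of entry i.  Forbidding v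
   to be adjacent, after insertion, to the entry following it selects one
   insertion among those that create the same run of consecutive values. *)
Definition reduced_insertion (n : nat) (pi : 'S_n) : {set 'I_n * 'I_n.+1} :=
  [set x : 'I_n * 'I_n.+1 | (x.2 != pi x.1 :> nat) && (x.2 != (pi x.1).+1 :> nat)].

(** If insertions at [a < b] agreed, then the value [v] inserted at [a] would equal the entry [pi a]
    of the other result, possibly raised by one; both values are forbidden. With equal positions,
    the inserted values can be read off. *)
Lemma reduced_insertion_inj (n : nat) (pi : 'S_n) :
  {in reduced_insertion pi &,
    injective (fun x => lift_perm (widen_ord (leqnSn n) x.1) x.2 pi)}.
Proof.
have lt_absurd (a b : 'I_n) (v w : 'I_n.+1) : (a, v) \in reduced_insertion pi ->
    lift_perm (widen_ord (leqnSn n) a) v pi =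
      lift_perm (widen_ord (leqnSn n) b) w pi -> (a < b)%N -> False.
  rewrite inE /= => /andP[v1 v2] E ab.
  have : val v = bump w (pi a).
    rewrite -[v](lift_perm_id (widen_ord (leqnSn n) a) _ pi) E.
    have -> : widen_ord (leqnSn n) a = lift (widen_ord (leqnSn n) b) a.
      by apply/val_inj; rewrite /= /bump leqNgt ab.
    by rewrite lift_perm_lift.
  by move: v1 v2; rewrite /bump; case: (_ <= _)%N => /=; rewrite ?add0n ?add1n => /eqP ? /eqP ? ?.
move=> [a v] [b w] ha hb /= E; case: (ltngtP a b) => [ab|ba|/val_inj ab].
- by case: (lt_absurd _ _ _ _ ha E ab).
- by case: (lt_absurd _ _ _ _ hb (esym E) ba).
subst b; congr pair; rewrite -(lift_perm_id (widen_ord (leqnSn n) a) v pi) E.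
by rewrite lift_perm_id.
Qed.

Lemma card_upper_shadow_ge (n : nat) (pi : 'S_n) :
  (n * n.-1 <= #|upper_shadow pi|)%N.
Proof.
have sub : [set lift_perm (widen_ord (leqnSn n) x.1) x.2 pi | x in reduced_insertion pi]
    \subset upper_shadow pi.
  apply/fintype.subsetP => rho /imsetP[x _ ->]; rewrite inE; apply/coversP.
  by exists (widen_ord (leqnSn n) x.1), x.2.
apply: leq_trans (subset_leq_card sub); rewrite card_in_imset; last exact: reduced_insertion_inj.
have bad : (#|~: reduced_insertion pi| <= n * 2)%N.
  (* Each position forbids two values, [pi a] and [pi a + 1], and the boolean tells which. Both are
     at most [n], so [inord] stays in range. There remain [n (n + 1) - 2 n = n (n - 1)]
     insertions. *)
  have sub2 : ~: reduced_insertion pi \subset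
      [set (y.1, inord (pi y.1 + y.2)) | y : 'I_n * bool].
    apply/fintype.subsetP => -[a v]; rewrite !inE /= -negb_or negbK => h.
    apply/imsetP; exists (a, val v != pi a) => //=; congr pair; apply/val_inj => /=.
    have := ltn_ord (pi a); case: eqP h => [e _ lt|_ /= /eqP e lt]; rewrite inordK /=; lia.
  apply: (leq_trans (subset_leq_card sub2)); apply: (leq_trans (leq_imset_card _ _)).
  by rewrite card_prod card_ord card_bool.
have := cardsC (reduced_insertion pi); rewrite card_prod !card_ord.
by move: bad; case: n pi {sub} => [//|n] pi; move: #|_| #|_| => a b; rewrite /=; nia.
Qed.

(** * Moments of the number of selected sets contained in a random set *)

Lemma leq_expn2r (e m n : nat) : (m <= n)%N -> (m ^ e <= n ^ e)%N.
Proof. by case: e => // e mn; rewrite leq_exp2r. Qed.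

Lemma bin_le_expn (n j : nat) : ('C(n, j) <= n ^ j)%N.
Proof.
elim: j n => [|j IH] [|n]; rewrite ?bin0 ?bin0n //.
rewrite -(leq_pmul2l (ltn0Sn j)) -mul_bin_diag expnS mulnCA leq_mul //.
apply: (leq_trans (IH n)); apply: (@leq_trans (n.+1 ^ j)); first exact: leq_expn2r.
by rewrite leq_pmull.
Qed.

Section Moments.
Import fintype boot.finset.
Variables (R : realFieldType) (I : finType) (p : R) (mu : {set I} -> R).
Hypothesis mu_ge0 : forall A, 0 <= mu A.
(** The sum is the probability that the random set with law [mu] contains [S]; independence enters
    the moment computations only in this form. *)
Hypothesis mu_superset : forall S : {set I},
  \sum_(A : {set I} | S \subset A) mu A = p ^+ #|S|.
Variables (T : finType) (Q : {set T}) (F : T -> {set I}) (k : nat).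
Hypothesis card_F : forall t, t \in Q -> #|F t| = k.

Let Y (A : {set I}) : R := \sum_(t in Q) (F t \subset A)%:R.

Lemma sum_mu : \sum_A mu A = 1.
Proof.
rewrite -(expr0 p) -(cards0 I) -mu_superset.
by apply: eq_bigl => A; rewrite sub0set.
Qed.

Lemma binomial_param_ge0_of_point (i : I) : 0 <= p.
Proof.
by rewrite -[p]expr1 -(cards1 i) -mu_superset sumr_ge0.
Qed.

Lemma sum_mu_indicator (S : {set I}) :
  \sum_A mu A * (S \subset A)%:R = p ^+ #|S|.
Proof.
rewrite -mu_superset [RHS]big_mkcond; apply: eq_bigr => A _.
by case: ifP; rewrite ?mulr1 ?mulr0.
Qed.

Lemma mean_count : \sum_A mu A * Y A = #|Q|%:R * p ^+ k.
Proof.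
under eq_bigr do rewrite mulr_sumr.
rewrite exchange_big /= (eq_bigr (fun=> p ^+ k)) => [|t /card_F <-].
  by rewrite sumr_const mulr_natl.
exact: sum_mu_indicator.
Qed.

(** The product of the indicators of [F t] and [F u] is the indicator of their union. *)
Lemma second_moment_count :
  \sum_A mu A * Y A ^+ 2 = \sum_(t in Q) \sum_(u in Q) p ^+ #|F t :|: F u|.
Proof.
under eq_bigr => A _.
  rewrite expr2 mulr_suml mulr_sumr.
  under eq_bigr => t _ do rewrite mulr_sumr mulr_sumr.
  over.
rewrite exchange_big; apply: eq_bigr => t _.
rewrite exchange_big; apply: eq_bigr => u _.
rewrite -sum_mu_indicator; apply: eq_bigr => A _.
by rewrite subUset -natrM mulnb.
Qed.

(** Markov's inequality: [Y] is at least 1 on the event. *)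
Lemma first_moment_bound :
  \sum_(A : {set I} | [exists t in Q, F t \subset A]) mu A <= #|Q|%:R * p ^+ k.
Proof.
rewrite -mean_count big_mkcond; apply: ler_sum => A _.
case: ifP => [/exists_inP[t tQ tA]|_]; last by rewrite mulr_ge0 // sumr_ge0.
by rewrite ler_peMr // /Y (bigD1 t) //= tA lerDl sumr_ge0.
Qed.

(** Chebyshev's inequality without division: [Y - m] has square [m ^+ 2] wherever [Y] vanishes. In
    the variance, disjoint pairs cancel against [m ^+ 2], and for the others the subtracted square
    is dropped. *)
Lemma second_moment_bound : 0 <= p ->
  \sum_(A : {set I} | ~~ [exists t in Q, F t \subset A]) mu A
      * (#|Q|%:R * p ^+ k) ^+ 2
    <= p ^+ k * \sum_(t in Q) \sum_(u in Q | F t :&: F u != set0)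
                  p ^+ #|F u :\: F t|.
Proof.
move=> p0; set m := #|Q|%:R * p ^+ k.
have chebyshev : \sum_(A : {set I} | ~~ [exists t in Q, F t \subset A]) mu A * m ^+ 2
    <= \sum_A mu A * (Y A - m) ^+ 2.
  rewrite big_mkcond; apply: ler_sum => A _.
  case: ifP => [/exists_inPn none|_]; last by rewrite mulr_ge0 ?sqr_ge0.
  by rewrite /Y big1 ?sub0r ?sqrrN // => t /none /negbTE ->.
apply: (le_trans chebyshev).
have -> : \sum_A mu A * (Y A - m) ^+ 2 = \sum_A mu A * Y A ^+ 2 - m ^+ 2.
  have -> : m ^+ 2 = 2 * m * (\sum_A mu A * Y A) - m ^+ 2 * \sum_A mu A.
    by rewrite sum_mu mean_count -/m; ring.
  rewrite !mulr_sumr opprB addrC -!sumrB -!big_split; apply: eq_bigr => A _ /=; ring.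
rewrite second_moment_count lerBlDr.
have -> : m ^+ 2 = \sum_(t in Q) \sum_(u in Q) p ^+ k * p ^+ k.
  by rewrite !sumr_const -mulrnA -mulr_natl natrM /m; ring.
rewrite mulr_sumr -big_split; apply: ler_sum => t tQ /=.
rewrite mulr_sumr [X in _ <= X + _]big_mkcondr -big_split; apply: ler_sum => u uQ /=.
(* Making the union disjoint splits off the factor [p ^+ k] of [F t]; what remains is the
   conditional weight of [F u] given [F t]. *)
have -> : F t :|: F u = F t :|: (F u :\: F t) by apply/setP => i; rewrite !inE; case: (i \in F t).
have -> : #|F t :|: (F u :\: F t)| = (k + #|F u :\: F t|)%N.
  have -> : #|F t :|: (F u :\: F t)| = (#|F t| + #|F u :\: F t|)%N.
    apply/eqP; rewrite (leq_card_setU (F t) (F u :\: F t)).2.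
    by rewrite -setI_eq0; apply/eqP/setP => i; rewrite !inE; case: (i \in F t).
  by rewrite card_F.
rewrite exprD; case: ifPn => [_|/negPn/eqP disj].
  by rewrite lerDl mulr_ge0 ?exprn_ge0.
by rewrite cardsD [F u :&: F t]setIC disj cards0 subn0 card_F // add0r.
Qed.

End Moments.

(** * Pairs of an index and a k-subset of its set *)

Section KSubsets.
Import fintype boot.finset.
Variables (K I : finType) (D : K -> {set I}) (k : nat).

Definition k_subsets : {set K * {set I}} :=
  [set x : K * {set I} | (x.2 \subset D x.1) && (#|x.2| == k)].

Lemma k_subsetsP (A : {set I}) :
  [exists t in k_subsets, t.2 \subset A] = [exists x, (k <= #|A :&: D x|)%N].
Proof.
apply/exists_inP/existsP => [[[x S]]|[x /card_geqP[s [us sk sA]]]].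
  rewrite inE /= => /andP[SD /eqP <-] SA; exists x.
  by rewrite subset_leq_card // subsetI SA.
exists (x, [set i in s]) => /=.
  rewrite inE /= cardsE (card_uniqP us) sk eqxx andbT.
  by apply/subsetP => i; rewrite inE => /sA; rewrite inE => /andP[].
by apply/subsetP => i; rewrite inE => /sA; rewrite inE => /andP[].
Qed.

Lemma sum_k_subsets (V : nmodType) (P : pred {set I}) (f : {set I} -> V) :
  \sum_(u in k_subsets | P u.2) f u.2 =
  \sum_x \sum_(S : {set I} | [&& S \subset D x, #|S| == k & P S]) f S.
Proof.
rewrite pair_big_dep /=; apply: eq_bigl => -[x S] /=.
by rewrite inE /= andbA.
Qed.

Lemma card_k_subsets : #|k_subsets| = (\sum_x 'C(#|D x|, k))%N.
Proof.
rewrite -sum1_card -(eq_bigl _ _ (fun u => andbT (u \in k_subsets))).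
rewrite (sum_k_subsets predT (fun=> 1%N)); apply: eq_bigr => x _.
rewrite -cards_draws -sum1_card; apply: eq_bigl => S.
by rewrite !inE andbT.
Qed.

(** With its trace on [S] fixed, [U] is determined by [U :\: S], a subset of [B] with [k - #|T|]
    elements. *)
Lemma card_subsets_prescribed_trace (B S T : {set I}) : (#|T| <= k)%N ->
  (#|[set U : {set I} | [&& U \subset B, #|U| == k & S :&: U == T]]|
     <= #|B| ^ (k - #|T|))%N.
Proof.
move=> Tk; set W := [set U | _].
have inj : {in W &, injective (fun U => U :\: S)}.
  move=> U V; rewrite !inE => /and3P[_ _ /eqP UT] /and3P[_ _ /eqP VT] e.
  by rewrite -(setID U S) -(setID V S) e ![_ :&: S]setIC UT VT.
rewrite -(card_in_imset inj).
have sub : [set U :\: S | U in W] \subset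
    [set V : {set I} | V \subset B & #|V| == (k - #|T|)%N].
  apply/subsetP => V /imsetP[U UW ->]; move: UW; rewrite !inE => /and3P[UB /eqP Uk /eqP UT].
  by rewrite (subset_trans (subsetDl _ _)) //= cardsD setIC UT Uk.
apply: (leq_trans (subset_leq_card sub)).
by rewrite cards_draws bin_le_expn.
Qed.

(** Sort the sets [U] by their trace [T] on [S], with at most [2 ^ k] choices. For each [x], a
    nonempty trace contributes at most [(N p) ^ (k - #|T|)]. Only indices [x] with [D x] meeting [S]
    count, and there are at most [k c] of them. *)
Lemma sum_overlapping_k_subsets (R : realFieldType) (p q : R) (c N : nat)
    (S : {set I}) :
  (forall x, #|D x| <= N)%N -> (forall i, #|[set x | i \in D x]| <= c)%N ->
  0 <= p -> 1 <= q -> N%:R * p <= q -> #|S| = k ->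
  \sum_(u in k_subsets | S :&: u.2 != set0) p ^+ #|u.2 :\: S|
    <= (k * c * 2 ^ k)%:R * q ^+ k.-1.
Proof.
move=> DN Dc p0 q1 Npq Sk.
rewrite (sum_k_subsets (fun U => S :&: U != set0) (fun U => p ^+ #|U :\: S|)).
have inner x : \sum_(U : {set I} | [&& U \subset D x, #|U| == k & S :&: U != set0])
    p ^+ #|U :\: S| <= (2 ^ k)%:R * q ^+ k.-1.
  rewrite (partition_big (fun U => S :&: U) (fun T => T \in powerset S)) => [|U _] /=; last first.
    by rewrite inE subsetIl.
  rewrite -Sk -card_powerset Sk mulr_natl -sumr_const.
  apply: ler_sum => T; rewrite inE => TS.
  have Tk : (#|T| <= k)%N by rewrite -Sk subset_leq_card.
  have [->|T0] := eqVneq T set0.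
    by rewrite big1 ?exprn_ge0 ?(le_trans ler01) // => U /andP[/and3P[_ _ /negPf ->]].
  apply: (@le_trans _ _ (\sum_(U in [set U : {set I} |
      [&& U \subset D x, #|U| == k & S :&: U == T]]) p ^+ (k - #|T|))).
    rewrite [leLHS]big_mkcond [leRHS]big_mkcond; apply: ler_sum => U _.
    rewrite inE; case: (U \subset D x) => //=; case: eqP => //= Uk.
    case: (eqVneq (S :&: U) T) => [UT|]; last by rewrite andbF.
    by rewrite UT T0 /= cardsD setIC UT Uk.
  rewrite sumr_const -mulr_natl.
  apply: (@le_trans _ _ ((N%:R * p) ^+ (k - #|T|))).
    rewrite exprMn ler_wpM2r ?exprn_ge0 // -natrX ler_nat.
    exact: (leq_trans (card_subsets_prescribed_trace _ _ Tk)) (leq_expn2r _ _).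
  apply: (@le_trans _ _ (q ^+ (k - #|T|))).
    by rewrite lerXn2r ?nnegrE ?mulr_ge0 // (le_trans ler01).
  (* As the trace is nonempty the exponent is at most [k - 1], and [1 <= q] allows raising it to
     that. *)
  rewrite ler_weXn2l //; have : (0 < #|T|)%N by rewrite card_gt0.
  by lia.
pose X := [set x | S :&: D x != set0].
have XC : (#|X| <= k * c)%N.
  have sub : X \subset \bigcup_(i in S) [set x | i \in D x].
    apply/subsetP => x; rewrite inE => /set0Pn[i]; rewrite inE => /andP[iS iD].
    by apply/bigcupP; exists i; rewrite ?inE.
  apply: (leq_trans (subset_leq_card sub)).
  apply: (@leq_trans (\sum_(i in S) #|[set x | i \in D x]|)).
    apply: (big_ind2 (fun (A : {set K}) n => (#|A| <= n)%N)) => // [|A a B b Aa Bb].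
      by rewrite cards0.
    by rewrite (leq_trans (leq_card_setU _ _)) // leq_add.
  by rewrite -Sk -sum_nat_const leq_sum.
apply: (@le_trans _ _ (\sum_(x in X) (2 ^ k)%:R * q ^+ k.-1)).
  rewrite [leRHS]big_mkcond; apply: ler_sum => x _; rewrite inE.
  case: ifPn => // /negPn/eqP SD; rewrite big1 // => U /and3P[UD _ /negP[]].
  by rewrite -subset0 -SD setIS.
rewrite sumr_const -[leLHS]mulr_natl natrM -mulrA ler_wpM2r ?ler_nat //.
by rewrite mulr_ge0 ?exprn_ge0 // (le_trans ler01).
Qed.

End KSubsets.

(** * The covering problem *)

Local Open Scope classical_set_scope.
Local Open Scope ring_scope.

(** * The law of the random subset *)

Section Law.
Context (R : realType) (d : measure_display) (Omega : measurableType d)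
  (P : probability Omega R) (I : finType) (p : R) (C : Omega -> {set I}).
Hypothesis hC : binomial_random_subset P p C.

Definition law (A : {set I}) : R := fine (P [set w | C w = A]).

Lemma law_ge0 (A : {set I}) : 0 <= law A.
Proof. by rewrite fine_ge0. Qed.

(** The event is a finite intersection of membership events and complements of such events. *)
Lemma measurable_atom (A : {set I}) : measurable [set w | C w = A].
Proof.
have [mE _ _] := hC.
have -> : [set w | C w = A] =
    \bigcap_(i in [set: I]) (if i \in A then [set w | i \in C w] else ~` [set w | i \in C w]).
  apply/seteqP; split => [w <- i _ /=|w h]; first by case: ifPn => // /negP.
  apply/setP => i; have /= := h i Logic.I; case: (i \in A) => //= /negP /negbTE //.
apply: fin_bigcap_measurable => [|i _]; first exact: finite_finset.
by case: ifP => _; [|apply: measurableC].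
Qed.

Lemma law_pred (Q : pred {set I}) :
  P [set w | Q (C w)] = (\sum_(A : {set I} | Q A) law A)%:E.
Proof.
have -> : [set w | Q (C w)] = \bigcup_(A in [set` Q]) [set w | C w = A].
  by apply/seteqP; split => [w Qw|w [A QA /= ->]] //; exists (C w).
rewrite measure_fin_bigcup.
- rewrite -sumEFin -(@bigfs _ _ _ _ (index_enum _)) ?index_enum_uniq //; last first.
    by move=> A _; rewrite mem_index_enum.
  by apply: eq_bigr => A _; rewrite /law fineK // fin_num_measure //; exact: measurable_atom.
- exact: finite_finset.
- by move=> A B _ _ [w [/= eA eB]]; rewrite -eA.
- by move=> A _; exact: measurable_atom.
Qed.

Lemma law_superset (S : {set I}) :
  \sum_(A : {set I} | S \subset A) law A = p ^+ #|S|.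
Proof.
have [mE pE indep] := hC.
apply: EFin_inj; rewrite -law_pred.
have -> : [set w | S \subset C w] = \bigcap_(i in [set` S]) [set w | i \in C w].
  apply/seteqP; split => [w /fintype.subsetP SC i|w h]; first exact: SC.
  by apply/fintype.subsetP => i; exact: h.
rewrite indep (eq_bigr (fun=> p%:E)) => [|i _]; last exact: pE.
rewrite -prodr_const; elim/big_ind2: _ => // x1 x2 y1 y2 -> ->.
by rewrite EFinM.
Qed.

End Law.

(** * Counting k-subsets of upper shadows *)

Lemma num_overcovered_eq0 (lambda n : nat) (A : {set 'S_n.+1}) :
  (num_overcovered lambda A == 0%N) =
  ~~ [exists t in k_subsets (@upper_shadow n) lambda.+1, t.2 \subset A].
Proof.
rewrite k_subsetsP /num_overcovered; apply/eqP/existsPn => [/card0_eq none pi|none].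
  apply/negP => h; have /negP[] := negbT (none pi).
  apply/mem_set; apply: leq_trans h _.
  by apply: subset_leq_card; apply/fintype.subsetP => rho; rewrite !inE.
apply: eq_card0 => pi; apply/negbTE/negP => /set_mem h.
have /negP[] := none pi; apply: leq_trans h _.
by apply: subset_leq_card; apply/fintype.subsetP => rho; rewrite !inE.
Qed.

Lemma card_k_subsets_shadow_le (n k : nat) :
  (#|k_subsets (@upper_shadow n) k| <= n`! * (n.+1 ^ 2) ^ k)%N.
Proof.
rewrite card_k_subsets -(card_Sn n) -sum_nat_const; apply: leq_sum => pi _.
apply: (leq_trans (bin_le_expn _ _)).
exact/leq_expn2r/card_upper_shadow_le.
Qed.

Lemma card_k_subsets_shadow_ge (n k : nat) : (k + 4 <= n)%N ->
  (n`! * (n.+1 ^ 2) ^ k <= 4 ^ k * k`! * #|k_subsets (@upper_shadow n) k|)%N.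
Proof.
move=> kn.
have bin_ge : ((n.+1 ^ 2) ^ k <= 4 ^ k * k`! * 'C(n * n.-1, k))%N.
  (* The factor 4 absorbs both the passage from [(n + 1) ^ 2] to [n (n - 1)] and the loss of [k]. *)
  have le : (n.+1 ^ 2 <= 4 * (n * n.-1 - k))%N by case: n kn => //= n; nia.
  apply: (@leq_trans ((4 * (n * n.-1 - k)) ^ k)%N).
    exact: leq_expn2r.
  rewrite expnMn -mulnA leq_mul // [(k`! * _)%N]mulnC bin_ffact.
  (* Every factor of the falling factorial of length [k] from [m] is at least [m - k]. *)
  elim: (k) (n * n.-1)%N => [//|j IH] m; rewrite ffactnSr mulnC expnS.
  apply: leq_mul; first by rewrite leq_sub2l.
  by apply: leq_trans (IH m); apply: leq_expn2r; rewrite leq_sub2l.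
rewrite card_k_subsets -(card_Sn n) -sum_nat_const big_distrr /=.
apply: leq_sum => pi _; apply: (leq_trans bin_ge); rewrite leq_mul //.
by rewrite leq_bin2l // card_upper_shadow_ge.
Qed.

(** * Nonasymptotic bounds for fixed [n] *)

Section Bounds.
Context (R : realType) (lambda n : nat) (d : measure_display)
  (Omega : measurableType d) (P : probability Omega R) (p : R)
  (C : Omega -> {set 'S_n.+1}).
Hypothesis hC : binomial_random_subset P p C.

Let k := lambda.+1.

Definition prob_none : R := fine (P [set w | num_overcovered lambda (C w) = 0%N]).

Let hit (A : {set 'S_n.+1}) :=
  [exists t in k_subsets (@upper_shadow n) k, t.2 \subset A].

Lemma prob_none_law :
  P [set w | num_overcovered lambda (C w) = 0%N] =
  (\sum_(A : {set 'S_n.+1} | ~~ hit A) law P C A)%:E.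
Proof.
rewrite -(law_pred hC (fun A => ~~ hit A)); congr (P _).
by apply/seteqP; split => w /=; rewrite /hit -num_overcovered_eq0 => /eqP.
Qed.

Lemma prob_noneE : prob_none = \sum_(A : {set 'S_n.+1} | ~~ hit A) law P C A.
Proof. by rewrite /prob_none prob_none_law. Qed.

Lemma prob_none_fineK : P [set w | num_overcovered lambda (C w) = 0%N] = prob_none%:E.
Proof. by rewrite /prob_none prob_none_law. Qed.

Lemma prob_none_ge0 : 0 <= prob_none.
Proof. by rewrite prob_noneE sumr_ge0 // => A _; exact: law_ge0. Qed.

Lemma binomial_param_ge0 : 0 <= p.
Proof. exact: (binomial_param_ge0_of_point (law_ge0 P C) (law_superset hC) 1%g). Qed.

Lemma card_k_subset (t : 'S_n * {set 'S_n.+1}) :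
  t \in k_subsets (@upper_shadow n) k -> #|t.2| = k.
Proof. by rewrite inE => /andP[_ /eqP]. Qed.

Lemma prob_noneC : 1 - prob_none = \sum_(A : {set 'S_n.+1} | hit A) law P C A.
Proof.
by rewrite prob_noneE -(sum_mu (law_superset hC)) (bigID hit) /= addrK.
Qed.

Lemma prob_some_le : 0 <= 1 - prob_none <= n`!%:R * (n.+1%:R ^+ 2 * p) ^+ k.
Proof.
rewrite prob_noneC sumr_ge0 => [|A _]; last exact: law_ge0.
apply: (le_trans (first_moment_bound (law_ge0 P C) (law_superset hC) card_k_subset)).
rewrite exprMn mulrA ler_wpM2r ?exprn_ge0 ?binomial_param_ge0 //.
by rewrite -!natrX -natrM ler_nat card_k_subsets_shadow_le.
Qed.

Lemma prob_none_le (t : R) : (k + 4 <= n)%N -> 0 < p -> t = n.+1%:R ^+ 2 * p ->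
  n%:R ^+ 2 <= n`!%:R * t ^+ k ->
  prob_none <= (8 * (4 ^ k * k`! * (k * 2 ^ k)))%:R * n.+1%:R^-1.
Proof.
move=> kn p0 tE n2_le.
set S := k_subsets (@upper_shadow n) k.
have t0 : 0 < t by rewrite tE mulr_gt0 ?exprn_gt0 ?ltr0n.
(* The maximum with 1 lets a single power bound all overlap sizes, for small and large [t] alike. *)
pose q := Num.max 1 t.
have S_gt0 : 0 < #|S|%:R :> R.
  have := card_k_subsets_shadow_ge kn; rewrite ltr0n -/S; case: #|S| => //.
  by rewrite muln0 leqn0 muln_eq0 !expn_eq0 /= -leqn0 leqNgt fact_gt0.
pose B : R := (k * n.+1 * 2 ^ k)%:R * q ^+ k.-1.
have second : prob_none * (#|S|%:R * p ^+ k) <= B.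
  have pos : 0 < #|S|%:R * p ^+ k by rewrite mulr_gt0 ?exprn_gt0.
  rewrite -(ler_pM2r pos) -mulrA -expr2 prob_noneE mulr_suml.
  apply: (le_trans (second_moment_bound (law_ge0 P C) (law_superset hC)
    card_k_subset (ltW p0))).
  rewrite [leRHS](_ : _ = p ^+ k * \sum_(u in S) B); last first.
    by rewrite sumr_const -[in RHS]mulr_natl; ring.
  rewrite ler_wpM2l ?exprn_ge0 ?(ltW p0) //; apply: ler_sum => u uS.
  apply: (@sum_overlapping_k_subsets _ _ _ _ R p q n.+1 (n.+1 ^ 2)).
  - exact: card_upper_shadow_le.
  - move=> rho; have := card_covered_le rho.
    by congr (_ <= _)%N; apply: eq_card => pi; rewrite !inE.
  - exact: ltW.
  - by rewrite le_max lexx.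
  - by rewrite natrX -tE le_max lexx orbT.
  - exact: card_k_subset uS.
(* [K0] is the price of replacing [#|S|] by [n! (n + 1) ^ (2 k)]; the other factor comes from
   [B]. *)
pose K0 := (4 ^ k * k`!)%N; pose K := (K0 * (k * 2 ^ k))%N.
have main : prob_none * (n`!%:R * t ^+ k) <= K%:R * n.+1%:R * q ^+ k.-1.
  have le1 : n`!%:R * t ^+ k <= K0%:R * (#|S|%:R * p ^+ k).
    rewrite tE exprMn !mulrA ler_wpM2r ?exprn_ge0 ?(ltW p0) //.
    by rewrite -!natrX -!natrM ler_nat card_k_subsets_shadow_ge.
  apply: (le_trans (ler_wpM2l prob_none_ge0 le1)).
  rewrite mulrCA; apply: (le_trans (ler_wpM2l (ler0n _ _) second)).
  by rewrite /B /K !natrM; lra.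
have n0 : (1 < n)%N by lia.
have fact_ge : (n%:R : R) ^+ 2 <= 2 * n`!%:R.
  rewrite -natrX -natrM ler_nat.
  case: (n) n0 => // -[|m] // _; rewrite factS.
  have : (m.+1 <= m.+1`!)%N by rewrite dvdn_leq ?fact_gt0 // factS dvdn_mulr.
  by nia.
(* If [t <= 1] then [q = 1] and the assumed lower bound on [n! t ^ k] suffices. If [t > 1] then
   [q = t], the power of [t] cancels, and [n ^ 2 <= 2 n!] takes over. *)
have bound : prob_none * n%:R ^+ 2 <= 2 * K%:R * n.+1%:R.
  have KN : 0 <= K%:R * n.+1%:R :> R by rewrite mulr_ge0.
  have [t1|t1] := leP t 1.
    move: main; rewrite /q (max_idPl t1) expr1n mulr1 => main.
    apply: (le_trans (ler_wpM2l prob_none_ge0 n2_le)); apply: (le_trans main).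
    by lra.
  apply: (le_trans (ler_wpM2l prob_none_ge0 fact_ge)).
  suff : prob_none * n`!%:R <= K%:R * n.+1%:R by lra.
  rewrite -(@ler_pM2r _ (t ^+ k)) ?exprn_gt0 // -mulrA.
  apply: (le_trans main); rewrite ler_wpM2l //.
  by rewrite /q (max_idPr (ltW t1)) ler_weXn2l ?(ltW t1).
rewrite ler_pdivlMr ?ltr0n // -(@ler_pM2r _ n.+1%:R) ?ltr0n // -mulrA -expr2.
(* Here [(n + 1) ^ 2 <= 4 n ^ 2], which with the 2 of [bound] gives the constant 8. *)
apply: (@le_trans _ _ (4 * (prob_none * n%:R ^+ 2))).
  rewrite [leRHS]mulrCA ler_wpM2l ?prob_none_ge0 // -!natrX -natrM ler_nat; nia.
by rewrite natrM -/K0 -/K; lra.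
Qed.

End Bounds.

(** * Passage to the limit on both sides of the threshold *)

Theorem theorem4p6 (R : realType) (lambda : nat) (hlambda : (1 <= lambda)%N)
    (p : nat -> R)
    (d : nat -> measure_display)
    (Omega : forall n : nat, measurableType (d n))
    (P : forall n : nat, probability (Omega n) R)
    (C : forall n : nat, Omega n -> {set 'S_n.+1})
    (hC : forall n : nat, binomial_random_subset (P n) (p n) (C n)) :
  ((p : nat -> R^o) =o_\oo
     (fun n : nat => 1 / n%:R ^+ 2 *
        (1 / n`!%:R `^ (1 / lambda.+1%:R)) : R^o) ->
   P n [set w | num_overcovered lambda (C n w) = 0%N] @[n --> \oo] --> 1%E)
  /\
  ((fun n : nat => 1 / n%:R `^ ((2 * lambda)%:R / lambda.+1%:R) *
        (1 / n`!%:R `^ (1 / lambda.+1%:R)) : R^o) =o_\oo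
     (p : nat -> R^o) ->
   P n [set w | num_overcovered lambda (C n w) = 0%N] @[n --> \oo] --> 0%E).
Proof.
pose k := lambda.+1; pose r n := prob_none lambda (P n) (C n).
pose s n : R := n`!%:R `^ (1 / k%:R).
have s_gt0 n : 0 < s n by rewrite powR_gt0 // ltr0n fact_gt0.
have sk n : s n ^+ k = n`!%:R.
  by rewrite -powR_mulrn ?powR_ge0 // -powRrM div1r mulVf ?pnatr_eq0 // powRr1.
have PE : (fun n => P n [set w | num_overcovered lambda (C n w) = 0%N]) = EFin \o r.
  by apply/funext => n; exact: prob_none_fineK (hC n).
have p_ge0 n : 0 <= p n by exact: binomial_param_ge0 (hC n).
split => /eqoP small; rewrite PE; apply: cvg_EFin; try by near=> n.
  apply/cvgrPdist_le => e e0 /=.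
  (* Capping at 1 gives [e1 ^+ k <= e1 <= e]. The later division by 4 compensates for
     [(n + 1) ^ 2 <= 4 n ^ 2]. *)
  pose e1 := Num.min e 1.
  have e1_gt0 : 0 < e1 by rewrite lt_min e0 ltr01.
  have {}small := small (e1 / 4) (divr_gt0 e1_gt0 (ltr0n _ 4)).
  near=> n.
  have n0 : (0 < n)%N by near: n; exact: nbhs_infty_gt.
  have nR : 0 < n%:R :> R by rewrite ltr0n.
  have : `|p n| <= e1 / 4 * `|1 / n%:R ^+ 2 * (1 / s n)| by near: n.
  rewrite (ger0_norm (p_ge0 n)) ger0_norm; last first.
    by rewrite mulr_ge0 ?divr_ge0 ?exprn_ge0 ?(ltW (s_gt0 n)) // ltW.
  move=> small_n.
  have /andP[ge0 le1] := prob_some_le lambda (hC n).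
  rewrite /r ger0_norm //; apply: (le_trans le1).
  rewrite -sk -exprMn.
  have base : s n * (n.+1%:R ^+ 2 * p n) <= e1.
    have sp : s n * p n * n%:R ^+ 2 <= e1 / 4.
      move: small_n; rewrite !div1r -invfM mulrC ler_pdivlMl ?mulr_gt0 ?exprn_gt0 //.
      by move=> h; rewrite mulrAC (mulrC (s n)) ?mulrA // -mulrA mulrC.
    have n4 : (n.+1%:R : R) ^+ 2 <= 4 * n%:R ^+ 2.
      by rewrite -!natrX -natrM ler_nat; nia.
    have spos : 0 <= s n * p n by rewrite mulr_ge0 ?(ltW (s_gt0 n)).
    have := ler_wpM2l spos n4; lra.
  apply: (@le_trans _ _ (e1 ^+ k)).
    by rewrite lerXn2r ?nnegrE ?mulr_ge0 ?exprn_ge0 // ?(ltW (s_gt0 n)) // ltW.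
  apply: (@le_trans _ _ e1); last by rewrite ge_min lexx.
  by rewrite exprS ler_piMr ?(ltW e1_gt0) // exprn_ile1 ?(ltW e1_gt0) // ge_min lexx orbT.
pose K := (8 * (4 ^ k * k`! * (k * 2 ^ k)))%:R : R.
have lim0 : K * n.+1%:R^-1 @[n --> \oo] --> (0 : R).
  by rewrite -(mulr0 K); apply: cvgM; [exact: cvg_cst|exact: cvg_harmonic].
apply: squeeze_cvgr (cvg_cst 0) lim0.
(* The constant 1 is enough: eventually [u s p >= 1], where [u = n ^ (2 lambda / k)]. *)
have {}small := small 1 ltr01.
near=> n; rewrite (prob_none_ge0 lambda (hC n)) /=.
have kn : (k + 4 <= n)%N by near: n; exact: nbhs_infty_ge.
have nR : 0 < n%:R :> R by rewrite ltr0n; lia.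
have : `|1 / n%:R `^ ((2 * lambda)%:R / k%:R) * (1 / s n)| <= 1 * `|p n| by near: n.
set u : R := n%:R `^ _ => small_n.
have u_gt0 : 0 < u by rewrite powR_gt0.
have uk : u ^+ k = n%:R ^+ (2 * lambda).
  rewrite -powR_mulrn ?powR_ge0 // -powRrM divfK ?pnatr_eq0 //.
  by rewrite powR_mulrn // ltW.
have us_gt0 : 0 < u * s n by rewrite mulr_gt0.
move: small_n; rewrite !mul1r (ger0_norm (p_ge0 n)) -invfM gtr0_norm ?invr_gt0 // => us_le.
have p_gt0 : 0 < p n by apply: lt_le_trans us_le; rewrite invr_gt0.
apply: (prob_none_le (hC n) kn p_gt0 erefl).
have one_le : 1 <= (u * s n * p n) ^+ k.
  by rewrite exprn_ege1 // mulrC -ler_pdivrMr // div1r.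
rewrite !exprMn uk sk in one_le.
(* Multiplying the goal by [n ^ (2 lambda)] clears the fractional power. Since [2 lambda + 2 = 2 k],
   the left side becomes [n ^ (2 k)], while by [one_le] the right side is at least
   [(n + 1) ^ (2 k)]. *)
rewrite -(ler_pM2l (exprn_gt0 (2 * lambda) nR)) exprMn.
have pow_le : (n%:R : R) ^+ (2 * lambda) * n%:R ^+ 2 <= (n.+1%:R ^+ 2) ^+ k.
  rewrite -exprD -exprM (_ : (2 * lambda + 2 = 2 * k)%N); last by rewrite /k; lia.
  by rewrite lerXn2r ?nnegrE ?ler_nat // ltW.
apply: (le_trans pow_le); rewrite -[leLHS]mulr1.
have := ler_wpM2l (exprn_ge0 k (exprn_ge0 2 (ler0n R n.+1))) one_le; lra.
Unshelve. all: by end_near.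
Qed.
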